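(* Let $n$ be a natural number and let $\Vdash_n$ be any one of $\models_n$, $\models^\alpha_n$, $\models^s_n$. Then intuitionistic propositional logic $\mathrm{IL}$ is base-complete over $\Vdash_n$ if and only if $\Vdash_n$ enjoys the compact export principle and $\mathrm{IL}$ is complete over $\Vdash_n$.
   Context: LANGUAGE. $\mathscr{L}$ is the propositional language whose formulas are built from infinitely many propositional letters and the atomic constant $\bot$ by $\wedge,\vee,\rightarrow$; $\neg X := X \rightarrow \bot$. $\mathrm{ATOM}$ is the set of the letters together with $\bot$. $\Gamma,\Delta$ always range over finite sets of formulas. ATOMIC RULES. A rule of level $0$ is an atom (an axiom). A rule of level $1$ infers an atom $A$ from atoms $A_1,\dots,A_m$. For $k\ge 1$, if $\Re_1,\dots,\Re_m$ are finite sets of atomic rules (some possibly empty) of maximal level $k-1$, then $([\Re_1]A_1,\dots,[\Re_m]A_m)/A$, which infers the atom $A$ from the atoms $A_1,\dots,A_m$ and discharges the rules in $\Re_i$ in the derivation of the $i$-th premise, is a rule of level $k+1$. ATOMIC BASES. An atomic base is a (possibly infinite) set $\mathfrak{B}$ of atomic rules containing the explosion rule $\bot/A$ for every atom $A$; its level is the maximal level of its rules other than the explosion rules ($0$ if there are none). $\mathbb{B}^n$ is the set of bases of level $\le n$. $\mathfrak{C}\supseteq_n\mathfrak{B}$ means $\mathfrak{C}\supseteq\mathfrak{B}$ and $\mathfrak{C}\in\mathbb{B}^n$. Derivations in $\mathfrak{B}$ are defined inductively: an atom $A$ is a single-node derivation of $A$, from no assumed rules if the axiom $A\in\mathfrak{B}$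 is applied, and from the assumed rule $A$ if $A$ is assumed; if $\mathscr{D}_i$ derives $A_i$ from assumed rules $\mathfrak{C}_i\cup\Re_i$ ($i\le m$), then applying $R=([\Re_1]A_1,\dots,[\Re_m]A_m)/A$ yields a derivation of $A$ from $\bigcup_i\mathfrak{C}_i$ if $R\in\mathfrak{B}$, and from $\bigcup_i\mathfrak{C}_i\cup\{R\}$ if $R\notin\mathfrak{B}$. $\vdash_{\mathfrak{B}}A$ means that there is a derivation of $A$ in $\mathfrak{B}$ from no assumed rules (a closed derivation). STANDARD BASE SEMANTICS. For $\mathfrak{B}\in\mathbb{B}^n$, define: for $A\in\mathrm{ATOM}$, $\models_{\mathfrak{B},n}A$ iff $\vdash_{\mathfrak{B}}A$; $\models_{\mathfrak{B},n}B\wedge C$ iff $\models_{\mathfrak{B},n}B$ and $\models_{\mathfrak{B},n}C$; $\models_{\mathfrak{B},n}B\vee C$ iff $\models_{\mathfrak{B},n}B$ or $\models_{\mathfrak{B},n}C$; $\models_{\mathfrak{B},n}B\rightarrow C$ iff $B\models_{\mathfrak{B},n}C$; for $\Gamma\ne\emptyset$, $\Gamma\models_{\mathfrak{B},n}A$ iff for all $\mathfrak{C}\supseteq_n\mathfrak{B}$, if $\models_{\mathfrak{C},n}B$ for all $B\in\Gamma$ then $\models_{\mathfrak{C},n}A$. $\Gamma\models_nA$ iff $\Gamma\models_{\mathfrak{B},n}A$ for all $\mathfrak{B}\in\mathbb{B}^n$. SANDQVIST'S BASE SEMANTICS. $\models^s_{\mathfrak{B},n}$ and $\models^s_n$ are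 defined by the same clauses (with $\models^s$ in place of $\models$ throughout), except that $\models^s_{\mathfrak{B},n}B\vee C$ iff for all $\mathfrak{C}\supseteq_n\mathfrak{B}$ and all $D\in\mathrm{ATOM}$, if $B\models^s_{\mathfrak{C},n}D$ and $C\models^s_{\mathfrak{C},n}D$ then $\models^s_{\mathfrak{C},n}D$. REDUCIBILITY SEMANTICS. An argument structure $\mathscr{D}=\langle T,\langle f,h,g\rangle\rangle$ consists of a finite rooted tree $T$ with nodes labelled by formulas ($\mu\prec\nu$ means that $\nu$ lies below $\mu$, towards the root), whose leaves are partitioned into assumption leaves $\mathrm{as}(T)$ and axiom leaves $\mathrm{ax}(T)$, and of partial discharge functions: $f$ is defined on a subset of $\mathrm{as}(T)$ with $\mu\prec f(\mu)$; $h$ is defined on a subset of $\mathrm{ax}(T)$ with $\mu\prec h(\mu)$, where $h(\mu)$ and its children are labelled by atoms and $h(\mu)$ is not a value of $f$; $g$ is defined on a set of sets $K$ of edges, each $K$ consisting of all and only the edges linking a node $\mu_K$ to its children, where $\mu_K$ and its children are labelled by atoms, $\mu_K$ is not a value of $f$, $\mu_K\prec g(K)$, $g(K)$ and its children are labelled by atoms, and $g(K)$ is not a value of $f$. ($f$ discharges assumptions; $h$ and $g$ discharge assumed atomic rules of level $0$ and higher.) The root label is the conclusion. $\mathscr{D}$ is from $\Gamma$ to $A$ if $\Gamma$ is the set of its undischarged assumptions and $A$ its conclusion; it is closed if $\Gamma=\emptyset$, open otherwise. Derivations in $\mathfrak{B}$ are regarded as argument structures with all labels atomic and $f$ empty.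 $\mathscr{D}[\mathscr{D}^{**}/\mathscr{D}^*]$ is the result of replacing the sub-structure $\mathscr{D}^*$ by $\mathscr{D}^{**}$ in $\mathscr{D}$, the discharge functions being redefined in the natural way (discharges of surviving or copied assumptions and assumed rules take place at the corresponding nodes; the others disappear). If $\mathscr{D}$ is from $\Gamma=\{\mu_1,\dots,\mu_m\}$ and $\sigma$ assigns to each $\mu_i$ an argument structure $\sigma(\mu_i)$ with the same conclusion as $\mu_i$, then $\mathscr{D}^\sigma=\mathscr{D}[\sigma(\mu_1),\dots,\sigma(\mu_m)/\mu_1,\dots,\mu_m]$; it is a closed $\sigma$-instance if all $\sigma(\mu_i)$ are closed. An inference is a triple $\langle\langle\mathscr{D}_1,\dots,\mathscr{D}_m\rangle,A,\delta\rangle$ with $\delta$ an extension of the discharge functions of the $\mathscr{D}_i$; its associated argument structure joins the trees of the $\mathscr{D}_i$ by a new root $A$ and adds the discharges $\delta$. A rule is a (recursive) set of inferences, its instances. Introduction rules are Gentzen's: $A,B/A\wedge B$; $A_i/A_1\vee A_2$ ($i=1,2$); $[A]B/A\rightarrow B$. $\mathscr{D}$ is canonical if it is associated to an instance of an introduction rule. A reduction for a rule $R$ is a map $\phi$ from and to argument structures, defined on some set $\mathbb{D}$ of argument structures associated to instances of $R$, such that for all $\mathscr{D}\in\mathbb{D}$: (a) if $\mathscr{D}$ is from $\Gamma$ to $A$, then $\phi(\mathscr{D})$ is from some $\Gamma^*\subseteq\Gamma$ to $A$; (b) for all $\sigma$, $\phi$ is defined on $\mathscr{D}^\sigma$ and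 $\phi(\mathscr{D}^\sigma)=\phi(\mathscr{D})^\sigma$. For a set $\mathfrak{J}$ of reductions, $\mathscr{D}\leq_{\mathfrak{J}}\mathscr{D}^*$ is the reflexive-transitive closure of: $\mathscr{D}^*=\mathscr{D}[\phi(\mathscr{D}^{**})/\mathscr{D}^{**}]$ for some sub-structure $\mathscr{D}^{**}$ of $\mathscr{D}$ and some $\phi\in\mathfrak{J}$. An argument is a pair $\langle\mathscr{D},\mathfrak{J}\rangle$. It is $n$-valid on $\mathfrak{B}\in\mathbb{B}^n$ iff: when $\mathscr{D}$ is closed with atomic conclusion, $\mathscr{D}\leq_{\mathfrak{J}}\mathscr{D}^*$ for some closed derivation $\mathscr{D}^*$ in $\mathfrak{B}$; when $\mathscr{D}$ is closed with non-atomic conclusion, $\mathscr{D}\leq_{\mathfrak{J}}\mathscr{D}^*$ for some canonical $\mathscr{D}^*$ whose immediate sub-structures, paired with $\mathfrak{J}$, are $n$-valid on $\mathfrak{B}$; when $\mathscr{D}$ is open with undischarged assumptions $\Gamma$, for all $\sigma$ assigning closed structures, all sets of reductions $\mathfrak{J}^+\supseteq\mathfrak{J}$ and all $\mathfrak{C}\supseteq_n\mathfrak{B}$, if $\langle\sigma(\mu),\mathfrak{J}^+\rangle$ is $n$-valid on $\mathfrak{C}$ for all $\mu\in\Gamma$, then $\langle\mathscr{D}^\sigma,\mathfrak{J}^+\rangle$ is $n$-valid on $\mathfrak{C}$. $\Gamma\models^\alpha_{\mathfrak{B},n}A$ means that some argument $\langle\mathscr{D},\mathfrak{J}\rangle$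 with $\mathscr{D}$ from $\Gamma$ to $A$ is $n$-valid on $\mathfrak{B}$. An argument is $n$-valid iff it is $n$-valid on every $\mathfrak{B}\in\mathbb{B}^n$; $\Gamma\models^\alpha_nA$ means that there is an $n$-valid argument $\langle\mathscr{D},\mathfrak{J}\rangle$ with $\mathscr{D}$ from $\Gamma$ to $A$. IL OVER BASES. $\Gamma\vdash_{\mathrm{IL}}A$ is derivability in intuitionistic propositional natural deduction. Extended derivations are built inductively from single formulas (assumed, or, for atoms, possibly used as axioms) by the rules of $\mathrm{IL}$ in the standard way and by applications of arbitrary atomic rules $([\Re_1]A_1,\dots,[\Re_m]A_m)/B$, which discharge the rules $\Re_i$ used in the derivation of the $i$-th premise. $\Gamma\vdash_{\mathrm{IL}\cup\mathfrak{B}}A$ means that there is an extended derivation from $\Gamma$ to $A$ whose only additional (undischarged) atomic rules are those in $\mathfrak{B}$. $\mathrm{IL}$ is base-complete over $\Vdash_n$ iff for all $\mathfrak{B}\in\mathbb{B}^n$, $\Gamma$ and $A$, $\Gamma\Vdash_{\mathfrak{B},n}A$ implies $\Gamma\vdash_{\mathrm{IL}\cup\mathfrak{B}}A$; it is complete over $\Vdash_n$ iff for all $\Gamma$ and $A$, $\Gamma\Vdash_nA$ implies $\Gamma\vdash_{\mathrm{IL}}A$. COMPACT EXPORT. To each atomic rule $R$ associate a disjunction-free formula $R^*$: $R^*=A$ if $R$ is the axiom $A$; if $R=([\Re_1]A_1,\dots,[\Re_m]A_m)/A$, then $R^*=\bigwedge_{i\le m}(\bigwedge_{\rho\in\Re_i}\rho^*\rightarrow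 A_i)\rightarrow A$, where the $i$-th conjunct is just $A_i$ if $\Re_i=\emptyset$. $\mathfrak{B}^*=\{R^*\mid R\in\mathfrak{B}\}$. $\Vdash_n$ enjoys the compact export principle iff for all $\mathfrak{B}\in\mathbb{B}^n$, $\Gamma$ and $A$: $\Gamma\Vdash_{\mathfrak{B},n}A$ iff there is a finite $\Delta\subseteq\mathfrak{B}^*$ such that $\Gamma,\Delta\Vdash_nA$. *)

(* Defs.v *)
From HB Require Import structures.
From Stdlib Require Import Relations.Relation_Operators.
From mathcomp Require Import all_boot finmap.
Set Implicit Arguments.
Unset Strict Implicit.
Unset Printing Implicit Defensive.

Local Open Scope fset_scope.
Local Open Scope nat_scope.

Inductive atom := Letter of nat | Bot.

Definition atom_enc (a : atom) : option nat :=
  if a is Letter k then Some k else None.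
Definition atom_dec (o : option nat) : atom :=
  if o is Some k then Letter k else Bot.
Lemma atom_encK : cancel atom_enc atom_dec. Proof. by case. Qed.
HB.instance Definition _ := Countable.copy atom (can_type atom_encK).

Inductive form :=
| Atom of atom
| And of form & form
| Or of form & form
| Imp of form & form.

Fixpoint form_enc (A : form) : GenTree.tree atom :=
  match A with
  | Atom a => GenTree.Leaf a
  | And A1 A2 => GenTree.Node 0 [:: form_enc A1; form_enc A2]
  | Or A1 A2 => GenTree.Node 1 [:: form_enc A1; form_enc A2]
  | Imp A1 A2 => GenTree.Node 2 [:: form_enc A1; form_enc A2]
  end.
Fixpoint form_dec (t : GenTree.tree atom) : form :=
  match t with
  | GenTree.Leaf a => Atom a
  | GenTree.Node 0 [:: t1; t2] => And (form_dec t1) (form_dec t2)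
  | GenTree.Node 1 [:: t1; t2] => Or (form_dec t1) (form_dec t2)
  | GenTree.Node 2 [:: t1; t2] => Imp (form_dec t1) (form_dec t2)
  | _ => Atom Bot
  end.
Lemma form_encK : cancel form_enc form_dec.
Proof. by elim=> [a|A1 /= -> A2 ->|A1 /= -> A2 ->|A1 /= -> A2 ->]. Qed.
HB.instance Definition _ := Countable.copy form (can_type form_encK).

Definition atomic (A : form) : bool := if A is Atom _ then true else false.

(** * Atomic rules and bases *)

(* [Rule [:: (Rs1, A1); ...; (Rsm, Am)] A] is ([Rs1]A1, ..., [Rsm]Am)/A; the
   axiom A is the case m = 0. *)
Inductive arule := Rule of seq (seq arule * atom) & atom.

Fixpoint arule_enc (R : arule) : GenTree.tree atom :=
  let: Rule ps a := R in
  GenTree.Node 0 (GenTree.Leaf a ::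
    map (fun p => GenTree.Node 0 (GenTree.Leaf p.2 :: map arule_enc p.1)) ps).
Fixpoint arule_dec (t : GenTree.tree atom) : arule :=
  match t with
  | GenTree.Node _ (GenTree.Leaf a :: ts) =>
      Rule (map (fun u => match u with
                 | GenTree.Node _ (GenTree.Leaf b :: us) => (map arule_dec us, b)
                 | _ => ([::], Bot)
                 end) ts) a
  | _ => Rule [::] Bot
  end.
Lemma arule_encK : cancel arule_enc arule_dec.
Proof.
rewrite /cancel; fix IH 1 => -[ps a] /=; congr Rule.
elim: ps => //= -[Rs b] ps -> /=; congr ((_, _) :: _).
by elim: Rs => //= R Rs ->; rewrite IH.
Qed.
HB.instance Definition _ := Countable.copy arule (can_type arule_encK).

(* The finite sets of discharged rules are represented by lists; a rule is
   normal when each of them is the unique list that is strictly increasing for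
   the numbering [pickle], so that equality of normal rules is equality of rules
   whose discharged rules form sets. *)
Fixpoint normal (R : arule) : bool :=
  let: Rule ps _ := R in
  all (fun p => sorted ltn (map choice.pickle p.1) && all normal p.1) ps.

Fixpoint level (R : arule) : nat :=
  let: Rule ps _ := R in
  foldr maxn 0
    (map (fun p => if p.1 is [::] then 1
                   else (foldr maxn 0 (map level p.1)).+2) ps).

Definition explosion (a : atom) : arule := Rule [:: ([::], Bot)] a.

Definition base := arule -> Prop.

Definition base_of_level (n : nat) (B : base) : Prop :=
  [/\ forall a, B (explosion a),
      forall R, B R -> normal R
    & forall R, B R -> (exists a, R = explosion a) \/ level R <= n].

Definition extends (n : nat) (B C : base) : Prop :=
  base_of_level n C /\ (forall R, B R -> C R).

(** * Argument structures *)

(* A tree together with its discharge functions f, h, g, given by relative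
   addresses: the number k points to the node reached by going k + 1 steps down
   towards the root (0 is the parent).  [Assum A k] is an assumption leaf, k its
   value under f; [Axm A h] is an axiom leaf, h its value under h;
   [Infer A g Ds] is an inner node with subtrees Ds above it, g the value under
   g of the set of edges linking it to its children.
   An address pointing beyond the root means, like [None], that the discharge
   function is undefined at that place.  Such addresses are kept since they
   identify the undischarged assumptions and assumed rules of a sub-structure:
   they tell at which nodes these are discharged in a larger structure, so that
   sub-structures are subtrees and can be replaced without readdressing. *)
Inductive astr :=
| Assum of form & nat
| Axm of form & option nat
| Infer of form & option nat & seq astr.

Fixpoint astr_enc (D : astr) : GenTree.tree (form * option nat) :=
  match D with
  | Assum A k => GenTree.Node 0 [:: GenTree.Leaf (A, Some k)]
  | Axm A h => GenTree.Node 1 [:: GenTree.Leaf (A, h)]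
  | Infer A g Ds => GenTree.Node 2 (GenTree.Leaf (A, g) :: map astr_enc Ds)
  end.
Fixpoint astr_dec (t : GenTree.tree (form * option nat)) : astr :=
  match t with
  | GenTree.Node 0 [:: GenTree.Leaf (A, Some k)] => Assum A k
  | GenTree.Node 1 [:: GenTree.Leaf (A, h)] => Axm A h
  | GenTree.Node 2 (GenTree.Leaf (A, g) :: ts) => Infer A g (map astr_dec ts)
  | _ => Assum (Atom Bot) 0
  end.
Lemma astr_encK : cancel astr_enc astr_dec.
Proof.
rewrite /cancel; fix IH 1 => -[A k|A h|A g Ds] //=; congr Infer.
by elim: Ds => //= D Ds ->; rewrite IH.
Qed.
HB.instance Definition _ := Countable.copy astr (can_type astr_encK).

Definition concl (D : astr) : form :=
  match D with Assum A _ | Axm A _ | Infer A _ _ => A end.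

(* Here and below d is the number of nodes on the path from D to the root. *)
Fixpoint assumptions_at (d : nat) (D : astr) : seq (form * nat) :=
  match D with
  | Assum A k => if d <= k then [:: (A, k - d)] else [::]
  | Axm _ _ => [::]
  | Infer _ _ Ds => flatten (map (assumptions_at d.+1) Ds)
  end.

Definition assumptions (D : astr) : seq (form * nat) := assumptions_at 0 D.

Definition undischarged (D : astr) : {fset form} :=
  [fset A | A in map fst (assumptions D)].

Definition closed (D : astr) : bool := nilp (assumptions D).

(* The applications of atomic rules that a larger structure may discharge, each
   given by its premises, its conclusion and the node where it is discharged. *)
Fixpoint assumed_rules_at (d : nat) (D : astr) : seq (seq form * form * nat) :=
  let outer ps A o :=
    if o is Some k then if d <= k then [:: (ps, A, k - d)] else [::] else [::] in
  match D with
  | Assum _ _ => [::]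
  | Axm A h => outer [::] A h
  | Infer A g Ds =>
      outer (map concl Ds) A g ++ flatten (map (assumed_rules_at d.+1) Ds)
  end.

Definition assumed_rules (D : astr) : seq (seq form * form * nat) :=
  assumed_rules_at 0 D.

(* The node A with subtrees Ds above it is a value of f. *)
Definition discharges_assumption (Ds : seq astr) : bool :=
  has (fun D => has (fun p => p.2 == 0) (assumptions D)) Ds.

Definition atomic_node (A : form) (Ds : seq astr) : bool :=
  [&& atomic A, all (fun D => atomic (concl D)) Ds
    & ~~ discharges_assumption Ds].

(* [ctx] tells which nodes below D may be values of h and g. *)
Fixpoint wf_in (ctx : seq bool) (D : astr) : bool :=
  let target o := if o is Some k then nth true ctx k else true in
  match D with
  | Assum _ _ => true
  | Axm _ h => target h
  | Infer A g Ds =>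
      [&& ~~ nilp Ds, isSome g ==> atomic_node A Ds, target g
        & all (wf_in (atomic_node A Ds :: ctx)) Ds]
  end.

Definition is_structure (D : astr) : bool := wf_in [::] D.

(** * Derivations in a base *)

(* The i-th member of [ctx] is the set of rules discharged by the i-th node
   below the derivation, in the premise to which the derivation belongs. *)
Definition available (B : base) (ctx : seq (seq arule)) (o : option nat)
    (R : arule) : Prop :=
  match o with
  | Some k => if k < size ctx then is_true (R \in nth [::] ctx k) else B R
  | None => B R
  end.

(* The assumed rules are those of [ctx].  A set of rules may be discharged even
   if not all its members are used, and a rule of B may also be assumed. *)
Inductive derivation (B : base) : seq (seq arule) -> astr -> Prop :=
| Derivation_axiom ctx a h :
    available B ctx h (Rule [::] a) -> derivation B ctx (Axm (Atom a) h)
| Derivation_rule ctx ps a g Ds :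
    ps <> [::] ->
    available B ctx g (Rule ps a) ->
    map concl Ds = map (fun p => Atom p.2) ps ->
    (forall i, i < size ps ->
       derivation B ((nth ([::], Bot) ps i).1 :: ctx)
         (nth (Assum (Atom Bot) 0) Ds i)) ->
    derivation B ctx (Infer (Atom a) g Ds).

Definition closed_derivation (B : base) (D : astr) : Prop := derivation B [::] D.

Definition provable (B : base) (a : atom) : Prop :=
  exists D, closed_derivation B D /\ concl D = Atom a.

(** * Standard base semantics and Sandqvist's base semantics *)

Definition consequence := {fset form} -> form -> Prop.

Fixpoint sat (n : nat) (A : form) (B : base) : Prop :=
  match A with
  | Atom a => provable B a
  | And A1 A2 => sat n A1 B /\ sat n A2 B
  | Or A1 A2 => sat n A1 B \/ sat n A2 B
  | Imp A1 A2 => forall C, extends n B C -> sat n A1 C -> sat n A2 C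
  end.

Fixpoint sat_s (n : nat) (A : form) (B : base) : Prop :=
  match A with
  | Atom a => provable B a
  | And A1 A2 => sat_s n A1 B /\ sat_s n A2 B
  | Or A1 A2 =>
      forall C, extends n B C -> forall a,
        (forall C', extends n C C' -> sat_s n A1 C' -> provable C' a) ->
        (forall C', extends n C C' -> sat_s n A2 C' -> provable C' a) ->
        provable C a
  | Imp A1 A2 => forall C, extends n B C -> sat_s n A1 C -> sat_s n A2 C
  end.

Definition consequence_on_of (n : nat) (V : form -> base -> Prop) (B : base) :
    consequence :=
  fun Gamma A =>
    if Gamma == fset0 then V A B
    else forall C, extends n B C -> (forall G, G \in Gamma -> V G C) -> V A C.

Definition consequence_of (n : nat) (V : form -> base -> Prop) : consequence :=
  fun Gamma A =>
    forall B, base_of_level n B -> consequence_on_of n V B Gamma A.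

(** * Substitution *)

(* Increases by d the addresses that point beyond the root. *)
Fixpoint shift_at (c d : nat) (D : astr) : astr :=
  let sh k := if c <= k then k + d else k in
  match D with
  | Assum A k => Assum A (sh k)
  | Axm A h => Axm A (omap sh h)
  | Infer A g Ds => Infer A (omap sh g) (map (shift_at c.+1 d) Ds)
  end.

Fixpoint subst_at (sigma : form * nat -> astr) (d : nat) (D : astr) : astr :=
  match D with
  | Assum A k => if d <= k then shift_at 0 d (sigma (A, k - d)) else D
  | Axm _ _ => D
  | Infer A g Ds => Infer A g (map (subst_at sigma d.+1) Ds)
  end.

Definition subst (sigma : form * nat -> astr) (D : astr) : astr :=
  subst_at sigma 0 D.

Definition assignment (sigma : form * nat -> astr) (D : astr) : Prop :=
  forall p, p \in assumptions D ->
    is_structure (sigma p) /\ concl (sigma p) = p.1.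

(** * Recursive sets *)

Inductive recfun :=
| RZero
| RSucc
| RProj of nat
| RComp of recfun & seq recfun
| RPrim of recfun & recfun
| RMin of recfun.

Inductive reval : recfun -> seq nat -> nat -> Prop :=
| Eval_zero v : reval RZero v 0
| Eval_succ x v : reval RSucc (x :: v) x.+1
| Eval_proj i v : i < size v -> reval (RProj i) v (nth 0 v i)
| Eval_comp f gs v ys z :
    size ys = size gs ->
    (forall i, i < size gs -> reval (nth RZero gs i) v (nth 0 ys i)) ->
    reval f ys z -> reval (RComp f gs) v z
| Eval_prim0 f g v z : reval f v z -> reval (RPrim f g) (0 :: v) z
| Eval_primS f g x v y z :
    reval (RPrim f g) (x :: v) y -> reval g [:: x, y & v] z ->
    reval (RPrim f g) (x.+1 :: v) z
| Eval_min f v w z :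
    (forall x, x < z -> reval f (x :: v) (w x).+1) ->
    reval f (z :: v) 0 -> reval (RMin f) v z.

Definition recursive (T : countType) (P : T -> Prop) : Prop :=
  exists f, forall x,
    (P x -> reval f [:: choice.pickle x] 1) /\ (~ P x -> reval f [:: choice.pickle x] 0).

(** * Inferences, rules, reductions *)

(* The inference <<D1, ..., Dm>, A, delta> is represented by
   ([:: D1; ...; Dm], A), where the assumptions and assumed rules of the Di
   discharged by delta at the new root are those with address 0. *)
Definition inference : Type := seq astr * form.

Definition associated (i : inference) (D : astr) : Prop :=
  exists g, D = Infer i.2 g i.1.

Definition introduction (i : inference) : bool :=
  let: (Ds, A) := i in
  match A, Ds with
  | And A1 A2, [:: D1; D2] =>
      [&& concl D1 == A1, concl D2 == A2 & ~~ discharges_assumption Ds]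
  | Or A1 A2, [:: D1] =>
      ((concl D1 == A1) || (concl D1 == A2)) && ~~ discharges_assumption Ds
  | Imp A1 A2, [:: D1] =>
      (concl D1 == A2)
      && all (fun p => (p.2 == 0) ==> (p.1 == A1)) (assumptions D1)
  | _, _ => false
  end.

Definition canonical (D : astr) : Prop :=
  exists2 i, introduction i & associated i D.

(* The last two inclusions say that the assumptions and the discharged assumed
   rules of E are surviving or copied from D. *)
Definition reduction_for (R : inference -> Prop) (phi : astr -> option astr) :
    Prop :=
  forall D E, phi D = Some E ->
    [/\ is_structure D /\ is_structure E,
        exists2 i, R i & associated i D,
        concl E = concl D,
        {subset assumptions E <= assumptions D}
          /\ {subset assumed_rules E <= assumed_rules D}
      & forall sigma, assignment sigma D ->
          phi (subst sigma D) = Some (subst sigma E)].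

Definition reduction (phi : astr -> option astr) : Prop :=
  exists2 R : inference -> Prop, recursive R & reduction_for R phi.

Definition redset := (astr -> option astr) -> Prop.

Definition is_redset (J : redset) : Prop := forall phi, J phi -> reduction phi.

Inductive reduces1 (J : redset) : astr -> astr -> Prop :=
| Reduces_root phi D E : J phi -> phi D = Some E -> reduces1 J D E
| Reduces_sub A g Ds1 D E Ds2 :
    reduces1 J D E ->
    reduces1 J (Infer A g (Ds1 ++ D :: Ds2)) (Infer A g (Ds1 ++ E :: Ds2)).

Definition reduces (J : redset) : astr -> astr -> Prop :=
  clos_refl_trans astr (reduces1 J).

(** * Validity *)

Definition validity := redset -> base -> astr -> Prop.

(* Validity of an arbitrary structure, given validity VG of closed structures
   with the conclusions of its assumptions, and validity VA of closed structures
   with its own conclusion. *)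
Definition valid_of (n : nat) (VG : form -> validity) (VA : validity) : validity :=
  fun J B D =>
    if closed D then VA J B D
    else forall sigma J' C,
      assignment sigma D ->
      (forall p, p \in assumptions D -> closed (sigma p)) ->
      is_redset J' -> (forall phi, J phi -> J' phi) ->
      extends n B C ->
      (forall p, p \in assumptions D -> VG p.1 J' C (sigma p)) ->
      VA J' C (subst sigma D).

(* Validity of closed structures with conclusion A, by recursion on A.  Since
   reductions do not introduce assumptions, the canonical structure is closed:
   the immediate sub-structures are closed in the cases of conjunction and
   disjunction, and have at most the assumption A1 in the case of A1 -> A2. *)
Fixpoint valid_closed (n : nat) (A : form) (J : redset) (B : base) (D : astr) :
    Prop :=
  match A with
  | Atom _ => exists D', reduces J D D' /\ closed_derivation B D'
  | And A1 A2 => exists g D1 D2,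
      let D' := Infer A g [:: D1; D2] in
      [/\ reduces J D D', canonical D',
          valid_closed n A1 J B D1 & valid_closed n A2 J B D2]
  | Or A1 A2 => exists g D1,
      let D' := Infer A g [:: D1] in
      [/\ reduces J D D', canonical D'
        & (concl D1 = A1 /\ valid_closed n A1 J B D1)
          \/ (concl D1 = A2 /\ valid_closed n A2 J B D1)]
  | Imp A1 A2 => exists g D1,
      let D' := Infer A g [:: D1] in
      [/\ reduces J D D', canonical D'
        & valid_of n (fun _ => valid_closed n A1) (valid_closed n A2) J B D1]
  end.

Definition valid (n : nat) : validity :=
  fun J B D => valid_of n (valid_closed n) (valid_closed n (concl D)) J B D.

Definition is_argument (D : astr) (J : redset) : Prop :=
  is_structure D /\ is_redset J.

Definition consequence_on_a (n : nat) (B : base) : consequence :=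
  fun Gamma A => exists D J,
    [/\ is_argument D J, undischarged D = Gamma, concl D = A & valid n J B D].

Definition consequence_a (n : nat) : consequence :=
  fun Gamma A => exists D J,
    [/\ is_argument D J, undischarged D = Gamma, concl D = A
      & forall B, base_of_level n B -> valid n J B D].

(** * The three consequence relations *)

Inductive semantics := Standard | Reducibility | Sandqvist.

Definition consequence_on (s : semantics) (n : nat) : base -> consequence :=
  match s with
  | Standard => consequence_on_of n (sat n)
  | Reducibility => consequence_on_a n
  | Sandqvist => consequence_on_of n (sat_s n)
  end.

Definition consequence_n (s : semantics) (n : nat) : consequence :=
  match s with
  | Standard => consequence_of n (sat n)
  | Reducibility => consequence_a n
  | Sandqvist => consequence_of n (sat_s n)
  end.

(** * Intuitionistic logic over a base *)

(* Existence of an extended derivation whose undischarged assumptions are in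
   Gamma and whose undischarged atomic rules are in B or in Rs. *)
Inductive ext_derivable (B : base) : seq arule -> {fset form} -> form -> Prop :=
| Ext_assumption Rs Gamma A : A \in Gamma -> ext_derivable B Rs Gamma A
| Ext_andI Rs Gamma A1 A2 :
    ext_derivable B Rs Gamma A1 -> ext_derivable B Rs Gamma A2 ->
    ext_derivable B Rs Gamma (And A1 A2)
| Ext_andE1 Rs Gamma A1 A2 :
    ext_derivable B Rs Gamma (And A1 A2) -> ext_derivable B Rs Gamma A1
| Ext_andE2 Rs Gamma A1 A2 :
    ext_derivable B Rs Gamma (And A1 A2) -> ext_derivable B Rs Gamma A2
| Ext_orI1 Rs Gamma A1 A2 :
    ext_derivable B Rs Gamma A1 -> ext_derivable B Rs Gamma (Or A1 A2)
| Ext_orI2 Rs Gamma A1 A2 :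
    ext_derivable B Rs Gamma A2 -> ext_derivable B Rs Gamma (Or A1 A2)
| Ext_orE Rs Gamma A1 A2 A :
    ext_derivable B Rs Gamma (Or A1 A2) ->
    ext_derivable B Rs (A1 |` Gamma) A -> ext_derivable B Rs (A2 |` Gamma) A ->
    ext_derivable B Rs Gamma A
| Ext_impI Rs Gamma A1 A2 :
    ext_derivable B Rs (A1 |` Gamma) A2 -> ext_derivable B Rs Gamma (Imp A1 A2)
| Ext_impE Rs Gamma A1 A2 :
    ext_derivable B Rs Gamma (Imp A1 A2) -> ext_derivable B Rs Gamma A1 ->
    ext_derivable B Rs Gamma A2
| Ext_botE Rs Gamma A :
    ext_derivable B Rs Gamma (Atom Bot) -> ext_derivable B Rs Gamma A
| Ext_rule Rs Gamma ps a :
    B (Rule ps a) \/ Rule ps a \in Rs ->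
    (forall p, p \in ps -> ext_derivable B (p.1 ++ Rs) Gamma (Atom p.2)) ->
    ext_derivable B Rs Gamma (Atom a).

Definition IL_over (B : base) : consequence := ext_derivable B [::].

Definition IL : consequence := IL_over (fun _ => False).

(** * Base-completeness, completeness, compact export *)

(* [bigand [::]] is not used. *)
Fixpoint bigand (As : seq form) : form :=
  match As with
  | [::] => Imp (Atom Bot) (Atom Bot)
  | [:: A] => A
  | A :: As' => And A (bigand As')
  end.

Fixpoint star (R : arule) : form :=
  let: Rule ps a := R in
  if ps is [::] then Atom a
  else Imp (bigand (map (fun p =>
              if p.1 is [::] then Atom p.2
              else Imp (bigand (map star p.1)) (Atom p.2)) ps)) (Atom a).

Definition base_star (B : base) (F : form) : Prop := exists2 R, B R & F = star R.

Definition base_complete (n : nat) (conB : base -> consequence) : Prop :=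
  forall B Gamma A, base_of_level n B ->
    conB B Gamma A -> IL_over B Gamma A.

Definition complete (con : consequence) : Prop :=
  forall Gamma A, con Gamma A -> IL Gamma A.

Definition compact_export (n : nat) (conB : base -> consequence)
    (con : consequence) : Prop :=
  forall B Gamma A, base_of_level n B ->
    (conB B Gamma A <->
     exists2 Delta : {fset form}, forall F, F \in Delta -> base_star B F
       & con (Gamma `|` Delta) A).

(* Main.v *)
From Stdlib Require Import Relations.Relation_Operators.
From mathcomp Require Import all_boot finmap.
From mathcomp Require Import zify.
Require Import Defs.
Set Implicit Arguments.
Unset Strict Implicit.
Unset Printing Implicit Defensive.

Local Open Scope fset_scope.
Local Open Scope nat_scope.

(** The theorem rests on two facts.  The first is purely proof-theoretic
    ([IL_over_exportP]): [A] is derivable from [Gamma] in intuitionistic logic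
    over a base [B] iff it is derivable in pure intuitionistic logic from [Gamma]
    and finitely many formulas [star R] with [R] in [B].  From left to right, each
    of the finitely many rules used is replaced by its formula; from right to left,
    [star R] is derivable over any base containing [R].  The second is soundness:
    what is derivable over [B] is a consequence on [B].

    Given soundness, and the fact that consequence is consequence on all bases of
    level at most [n], the equivalence is formal ([base_complete_of_sound]).  If
    intuitionistic logic is base-complete, then consequence on [B] coincides with
    derivability over [B], so that compact export is the first fact; and
    completeness is base-completeness on the base that has only the explosion
    rules, which derives nothing new.  Conversely, export and completeness lead
    from consequence on [B] to a derivation from finitely many [star R], and
    hence to a derivation over [B].

    For the standard semantics and for Sandqvist's, soundness is an induction on
    extended derivations ([ext_sound]); for an atomic rule one uses that adding
    the rules discharged at a premise to a base is an extension of level at most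
    [n], and that what holds there is derivable from the discharged rules as
    assumptions ([provable_rule]).

    Reducibility semantics is shown to define the same consequence relations as the
    standard one ([consequence_on_aP], [consequence_aP]).  The conclusion
    of a closed valid argument is satisfied.  For the converse, take the set of all
    reductions.  It contains, for each closed structure [E] without assumed rules,
    the reduction that sends to [E] every closed structure with the same
    conclusion that ends with an inference; this is a reduction because
    closed structures are invariant under substitution.  Hence a single inference
    from [Gamma] to [A], whatever its instances, is valid as soon as [A] is a
    standard consequence of [Gamma], and this structure and this set of reductions
    serve for all bases at once. *)

(** * Induction and choice principles *)

Lemma arule_nested_ind (P : arule -> Prop) :
  (forall (ps : seq (seq arule * atom)) a,
     (forall p, p \in ps -> forall R, R \in p.1 -> P R) -> P (Rule ps a)) ->
  forall R, P R.
Proof.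
move=> Prule; fix IH 1 => -[ps a]; apply: Prule.
elim: ps => [|[Rs b] ps IHps] p; first by clear IH.
have IHRs : forall R, R \in Rs -> P R.
  elim: Rs => [|R' Rs IHRs] R; first by clear IH.
  by have PR' := IH R'; clear IH; rewrite in_cons => /orP[/eqP->|/IHRs].
by clear IH; rewrite in_cons => /orP[/eqP->|/IHps].
Qed.

Lemma astr_nested_ind (P : astr -> Prop) :
  (forall A k, P (Assum A k)) -> (forall A h, P (Axm A h)) ->
  (forall A g (Ds : seq astr), (forall D, D \in Ds -> P D) -> P (Infer A g Ds)) ->
  forall D, P D.
Proof.
move=> Passum Paxm Pinfer; fix IH 1 => -[A k|A h|A g Ds]; [exact: Passum|exact: Paxm|].
apply: Pinfer.
elim: Ds => [|D' Ds IHDs] D; first by clear IH.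
by have PD' := IH D'; clear IH; rewrite in_cons => /orP[/eqP->|/IHDs].
Qed.

(** Finite choice along a list. *)
Lemma seq_choice (T U : Type) (t0 : T) (u0 : U) (Q : T -> U -> Prop) (s : seq T) :
  (forall i, i < size s -> exists u, Q (nth t0 s i) u) ->
  exists2 us, size us = size s &
    forall i, i < size s -> Q (nth t0 s i) (nth u0 us i).
Proof.
elim: s => [|t s IHs] Qs; first by exists [::].
have [u Qu] := Qs 0 isT.
have [us size_us Qus] := IHs (fun i lt_i => Qs i.+1 lt_i).
by exists (u :: us) => [|[|i]] //=; [rewrite size_us|exact: Qus].
Qed.

(** * Atomic derivability *)

(** Derivability of an atom from the rules of [B] and of the list [Rs] of
    assumed rules, without addresses for the discharges. *)
Inductive atomic_derivable (B : base) : seq arule -> atom -> Prop :=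
| Atomic_rule Rs ps a :
    B (Rule ps a) \/ Rule ps a \in Rs ->
    (forall p, p \in ps -> atomic_derivable B (p.1 ++ Rs) p.2) ->
    atomic_derivable B Rs a.

(** Moving rules between the base and the assumed rules is a special case. *)
Lemma atomic_derivable_weaken (B B' : base) (Rs Rs' : seq arule) (a : atom) :
  (forall R, B R \/ R \in Rs -> B' R \/ R \in Rs') ->
  atomic_derivable B Rs a -> atomic_derivable B' Rs' a.
Proof.
move=> sub der; elim: der Rs' sub => {Rs a} Rs ps a BR _ IH Rs' sub.
apply: (@Atomic_rule _ _ ps); first exact: sub.
move=> p ps_p; apply: IH => // R; rewrite !mem_cat => -[BR'|/orP[->|Rs_R]].
- by case: (sub R (or_introl BR')) => [|->]; [left|right; rewrite orbT].
- by right.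
- by case: (sub R (or_intror Rs_R)) => [|->]; [left|right; rewrite orbT].
Qed.

Lemma mem_flatten_nth (T : eqType) (ss : seq (seq T)) (x : T) :
  x \in flatten ss -> exists2 k, k < size ss & x \in nth [::] ss k.
Proof.
case/flattenP=> s ss_s s_x; exists (index s ss); first by rewrite index_mem.
by rewrite nth_index.
Qed.

Lemma derivation_atomic_derivable (B : base) (ctx : seq (seq arule)) (D : astr)
    (a : atom) :
  derivation B ctx D -> concl D = Atom a -> atomic_derivable B (flatten ctx) a.
Proof.
have avail ctx' o R : available B ctx' o R -> B R \/ R \in flatten ctx'.
  case: o => [k|] /=; last by left.
  case: ifP => [lt_k R_k|_]; last by left.
  by right; apply/flattenP; exists (nth [::] ctx' k); rewrite ?mem_nth.
move=> der; elim: der a => {ctx D} [ctx b h av|ctx ps b g Ds _ av eqDs _ IH] a /=.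
  by case=> <-; apply: (Atomic_rule (ps := [::])); first exact: avail av.
case=> <-; apply: (Atomic_rule (ps := ps)); first exact: avail av.
move=> p ps_p; have lt_i : index p ps < size ps by rewrite index_mem.
have eq_sz : size Ds = size ps by rewrite -(size_map concl) eqDs size_map.
have := IH _ lt_i p.2; rewrite nth_index //=; apply.
rewrite -(nth_map _ (Atom Bot)) ?eq_sz // eqDs (nth_map ([::], Bot)) //.
by rewrite nth_index.
Qed.

(** A structure without assumptions, at depth [d] in a larger one, whose
    discharged rules are all discharged at nodes below it in that larger one. *)
Definition discharged_within (d : nat) (D : astr) : Prop :=
  [/\ forall e, assumptions_at e D = [::], assumed_rules_at d D = [::]
    & forall b, all id b -> wf_in b D].

Lemma flatten_map_nil (T : eqType) (U : Type) (f : T -> seq U) (s : seq T) :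
  (forall x, x \in s -> f x = [::]) -> flatten (map f s) = [::].
Proof.
move=> f0; elim: s f0 => //= x s IH f0.
rewrite f0 ?mem_head // IH // => y s_y.
by apply: f0; rewrite in_cons s_y orbT.
Qed.

Lemma nth_all_id (b : seq bool) (k : nat) : all id b -> nth true b k.
Proof. by elim: b k => [|x b IH] [|k] //= /andP[] // _ /IH. Qed.

Lemma atomic_derivable_derivation (B : base) (Rs : seq arule) (a : atom)
    (ctx : seq (seq arule)) :
  {subset Rs <= flatten ctx} -> atomic_derivable B Rs a ->
  exists D, [/\ derivation B ctx D, concl D = Atom a
              & discharged_within (size ctx) D].
Proof.
move=> sub der; elim: der ctx sub => {Rs a} Rs ps a BR _ IH ctx sub.
(* An assumed rule gets the address of a node that discharges it, a rule of B the
   address None. *)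
have [o av o_lt] : exists2 o, available B ctx o (Rule ps a)
    & if o is Some k then k < size ctx else true.
  case: BR => [BR|/sub/mem_flatten_nth[k lt_k R_k]]; first by exists None.
  by exists (Some k) => //=; rewrite lt_k.
have target b : all id b -> (if o is Some k then nth true b k else true).
  by case: (o) => // k /nth_all_id.
case: ps => [|p0 ps'] in av BR IH *.
  exists (Axm (Atom a) o); split=> //; first exact: Derivation_axiom.
  split=> //=; first by case: o o_lt {av target} => //= k; rewrite ltnNge; case: leqP.
set ps := p0 :: ps' in av BR IH *.
have [Ds size_Ds Ds_ok] : exists2 Ds, size Ds = size ps &
    forall i, i < size ps -> [/\ derivation B ((nth ([::], Bot) ps i).1 :: ctx)
                                 (nth (Assum (Atom Bot) 0) Ds i),
       concl (nth (Assum (Atom Bot) 0) Ds i) = Atom (nth ([::], Bot) ps i).2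
     & discharged_within (size ctx).+1 (nth (Assum (Atom Bot) 0) Ds i)].
  pose Q p D := [/\ derivation B (p.1 :: ctx) D, concl D = Atom p.2
                  & discharged_within (size ctx).+1 D].
  apply: (@seq_choice _ _ ([::], Bot) (Assum (Atom Bot) 0) Q) => i lt_i.
  apply: IH; first by rewrite mem_nth.
  move=> R; rewrite /= !mem_cat => /orP[->//|/sub->]; exact: orbT.
have within D : D \in Ds -> discharged_within (size ctx).+1 D /\ atomic (concl D).
  move=> Ds_D; have lt_i : index D Ds < size ps by rewrite -size_Ds index_mem.
  have [_] := Ds_ok _ lt_i; rewrite nth_index // => eqD w; split=> //.
  by rewrite eqD.
have node : atomic_node (Atom a) Ds.
  rewrite /atomic_node /= /discharges_assumption.
  apply/andP; split; first by apply/allP=> D /within[].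
  by apply/hasPn=> D /within[[as0 _ _] _]; rewrite /assumptions as0.
exists (Infer (Atom a) o Ds); split=> //.
  apply: (Derivation_rule (ps := ps)) => // [|i lt_i]; last by case: (Ds_ok _ lt_i).
  apply: (@eq_from_nth _ (Atom Bot)); first by rewrite !size_map.
  rewrite size_map size_Ds => i lt_i; rewrite !(nth_map ([::], Bot)) //.
  by rewrite (nth_map (Assum (Atom Bot) 0)) ?size_Ds //; case: (Ds_ok _ lt_i).
split=> /= [e||b b1].
- by apply: flatten_map_nil => D /within[[]].
- rewrite flatten_map_nil ?cats0 => [|D /within[[]]//].
  by case: o o_lt {av target} => //= k; rewrite ltnNge; case: leqP.
- rewrite node implybT target //=; apply/andP; split.
    by rewrite /nilp size_Ds.
  by apply/allP=> D /within[[_ _ wfD] _]; apply: wfD; rewrite /= b1.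
Qed.

Lemma provableP (B : base) (a : atom) : provable B a <-> atomic_derivable B [::] a.
Proof.
split=> [[D [der eqD]]|/(@atomic_derivable_derivation _ _ _ [::])].
  exact: (derivation_atomic_derivable der eqD).
by case=> // D [der eqD _]; exists D.
Qed.

Lemma provable_mono (B C : base) (a : atom) :
  (forall R, B R -> C R) -> provable B a -> provable C a.
Proof.
move=> sub /provableP der; apply/provableP; apply: atomic_derivable_weaken der.
by move=> R [/sub|//]; left.
Qed.

(** Closure of a base under its own rules: the rules [p.1] discharged at a
    premise are those added to the base in which the premise is proved. *)
Lemma provable_rule (B : base) (ps : seq (seq arule * atom)) (a : atom) :
  B (Rule ps a) ->
  (forall p, p \in ps -> provable (fun R => B R \/ R \in p.1) p.2) ->
  provable B a.
Proof.
move=> BR prem; apply/provableP; apply: (Atomic_rule (ps := ps)); first by left.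
move=> p /prem/provableP; rewrite cats0; apply: atomic_derivable_weaken.
by move=> R [|].
Qed.

Lemma provable_explosion (n : nat) (B : base) (a : atom) :
  base_of_level n B -> provable B Bot -> provable B a.
Proof.
move=> [expB _ _] botB; apply: (provable_rule (expB a)) => p.
by rewrite inE => /eqP->; apply: provable_mono botB; left.
Qed.

(** * Bases *)

Lemma extends_refl (n : nat) (B : base) : base_of_level n B -> extends n B B.
Proof. by []. Qed.

Lemma extends_trans (n : nat) (B C C' : base) :
  extends n B C -> extends n C C' -> extends n B C'.
Proof. by move=> [_ sub] [lvl sub']; split=> // R /sub/sub'. Qed.

Lemma leq_foldr_maxn (s : seq nat) (m : nat) : m \in s -> m <= foldr maxn 0 s.
Proof.
elim: s => //= k s IH; rewrite in_cons => /orP[/eqP->|/IH le_m]; first exact: leq_maxl.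
exact: leq_trans le_m (leq_maxr _ _).
Qed.

Lemma level_discharged (ps : seq (seq arule * atom)) (a : atom) p R :
  p \in ps -> R \in p.1 -> level R <= level (Rule ps a).
Proof.
move=> ps_p p_R; apply: leq_trans (leq_foldr_maxn (map_f _ ps_p)).
have := leq_foldr_maxn (map_f level p_R).
by case: (p.1) p_R => // R' Rs' _ /leqW/leqW.
Qed.

Lemma normal_discharged (ps : seq (seq arule * atom)) (a : atom) p R :
  normal (Rule ps a) -> p \in ps -> R \in p.1 -> normal R.
Proof. by move=> /= /allP nps /nps/andP[_ /allP]; apply. Qed.

Lemma extends_discharged (n : nat) (B : base) (ps : seq (seq arule * atom))
    (a : atom) p :
  base_of_level n B -> B (Rule ps a) -> p \in ps ->
  extends n B (fun R => B R \/ R \in p.1).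
Proof.
move=> [expB nB lvlB] BR ps_p; split; last by left.
split=> [b|R [/nB//|p_R]|R [/lvlB//|p_R]]; first by left.
  exact: normal_discharged (nB _ BR) ps_p p_R.
case: (lvlB _ BR) => [[b [eqps _]]|le_n].
  by move: ps_p p_R; rewrite eqps inE => /eqP->.
by right; exact: leq_trans (level_discharged a ps_p p_R) le_n.
Qed.

(** The least base. *)
Definition explosion_base : base := fun R => exists a, R = explosion a.

Lemma base_of_level_explosion (n : nat) : base_of_level n explosion_base.
Proof. by split=> [a|R [a ->]|R]; [exists a| |left]. Qed.

(** * Structural properties of extended derivations *)

Lemma subset_fset1U (A : form) (Gamma Gamma' : {fset form}) :
  {subset Gamma <= Gamma'} -> {subset A |` Gamma <= A |` Gamma'}.
Proof.
by move=> sub F; rewrite !in_fset1U => /orP[->//|/sub->]; rewrite orbT.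
Qed.

Lemma ext_weaken (B B' : base) (Rs Rs' : seq arule) (Gamma Gamma' : {fset form})
    (A : form) :
  (forall R, B R \/ R \in Rs -> B' R \/ R \in Rs') ->
  {subset Gamma <= Gamma'} ->
  ext_derivable B Rs Gamma A -> ext_derivable B' Rs' Gamma' A.
Proof.
move=> sub subG der.
elim: der Rs' Gamma' sub subG => {Rs Gamma A}.
- by move=> Rs Gamma A GA Rs' Gamma' _ /(_ _ GA); exact: Ext_assumption.
- by move=> Rs Gamma A1 A2 _ IH1 _ IH2 Rs' Gamma' sub subG; apply: Ext_andI; auto.
- by move=> Rs Gamma A1 A2 _ IH Rs' Gamma' sub subG; apply: Ext_andE1; auto.
- by move=> Rs Gamma A1 A2 _ IH Rs' Gamma' sub subG; apply: Ext_andE2; eauto.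
- by move=> Rs Gamma A1 A2 _ IH Rs' Gamma' sub subG; apply: Ext_orI1; auto.
- by move=> Rs Gamma A1 A2 _ IH Rs' Gamma' sub subG; apply: Ext_orI2; auto.
- move=> Rs Gamma A1 A2 A _ IH _ IH1 _ IH2 Rs' Gamma' sub subG.
  by apply: (@Ext_orE _ _ _ A1 A2); [apply: IH|apply: IH1|apply: IH2] => //;
    exact: subset_fset1U.
- move=> Rs Gamma A1 A2 _ IH Rs' Gamma' sub subG; apply: Ext_impI.
  by apply: IH => //; exact: subset_fset1U.
- by move=> Rs Gamma A1 A2 _ IH1 _ IH2 Rs' Gamma' sub subG;
    apply: (@Ext_impE _ _ _ A1); auto.
- by move=> Rs Gamma A _ IH Rs' Gamma' sub subG; apply: Ext_botE; auto.
- move=> Rs Gamma ps a BR _ IH Rs' Gamma' sub subG.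
  apply: (@Ext_rule _ _ _ ps); first exact: sub.
  move=> p ps_p; apply: IH => // R; rewrite !mem_cat => -[BR'|/orP[->|Rs_R]].
  + by case: (sub R (or_introl BR')) => [|->]; [left|right; rewrite orbT].
  + by right.
  + by case: (sub R (or_intror Rs_R)) => [|->]; [left|right; rewrite orbT].
Qed.

Lemma ext_cut (B : base) (Rs : seq arule) (Gamma Gamma' : {fset form}) (A : form) :
  (forall G, G \in Gamma -> ext_derivable B Rs Gamma' G) ->
  ext_derivable B Rs Gamma A -> ext_derivable B Rs Gamma' A.
Proof.
have extend Rs0 (G1 G2 : {fset form}) F :
    (forall G, G \in G1 -> ext_derivable B Rs0 G2 G) ->
    forall G, G \in F |` G1 -> ext_derivable B Rs0 (F |` G2) G.
  move=> H G; rewrite in_fset1U => /orP[/eqP->|/H].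
    by apply: Ext_assumption; rewrite in_fset1U eqxx.
  by apply: ext_weaken => // E; rewrite in_fset1U orbC => ->.
move=> cut der; elim: der Gamma' cut => {Rs Gamma A}.
- by move=> Rs Gamma A GA Gamma'; exact.
- by move=> Rs Gamma A1 A2 _ IH1 _ IH2 Gamma' cut; apply: Ext_andI; auto.
- by move=> Rs Gamma A1 A2 _ IH Gamma' cut; apply: Ext_andE1; auto.
- by move=> Rs Gamma A1 A2 _ IH Gamma' cut; apply: Ext_andE2; eauto.
- by move=> Rs Gamma A1 A2 _ IH Gamma' cut; apply: Ext_orI1; auto.
- by move=> Rs Gamma A1 A2 _ IH Gamma' cut; apply: Ext_orI2; auto.
- move=> Rs Gamma A1 A2 A _ IH _ IH1 _ IH2 Gamma' cut.
  by apply: (@Ext_orE _ _ _ A1 A2); [apply: IH|apply: IH1|apply: IH2] => //;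
    exact: extend.
- move=> Rs Gamma A1 A2 _ IH Gamma' cut; apply: Ext_impI.
  by apply: IH; exact: extend.
- by move=> Rs Gamma A1 A2 _ IH1 _ IH2 Gamma' cut;
    apply: (@Ext_impE _ _ _ A1); auto.
- by move=> Rs Gamma A _ IH Gamma' cut; apply: Ext_botE; auto.
- move=> Rs Gamma ps a BR _ IH Gamma' cut.
  apply: (@Ext_rule _ _ _ ps) => // p ps_p; apply: IH => // G /cut.
  apply: ext_weaken => // R; rewrite mem_cat.
  by case=> [|->]; [left|right; rewrite orbT].
Qed.

Lemma ext_bigandI (B : base) (Rs : seq arule) (Gamma : {fset form})
    (As : seq form) :
  As <> [::] -> (forall A, A \in As -> ext_derivable B Rs Gamma A) ->
  ext_derivable B Rs Gamma (bigand As).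
Proof.
elim: As => // A [|A' As] IH _ der; first by apply: der; exact: mem_head.
apply: Ext_andI; first by apply: der; exact: mem_head.
by apply: IH => // F As_F; apply: der; rewrite in_cons As_F orbT.
Qed.

Lemma ext_bigandE (B : base) (Rs : seq arule) (Gamma : {fset form})
    (As : seq form) (A : form) :
  A \in As -> ext_derivable B Rs Gamma (bigand As) -> ext_derivable B Rs Gamma A.
Proof.
elim: As => // A' [|A'' As] IH; rewrite in_cons.
  by rewrite orbF => /eqP->.
case/orP=> [/eqP->|As_A] der; first exact: Ext_andE1 der.
by apply: IH => //; exact: Ext_andE2 der.
Qed.

(** * Atomic rules as formulas *)

(** The conjunct of [star (Rule ps a)] that corresponds to the premise [p]. *)
Definition premise_star (p : seq arule * atom) : form :=
  if p.1 is [::] then Atom p.2 else Imp (bigand (map star p.1)) (Atom p.2).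

Lemma star_rule (ps : seq (seq arule * atom)) (a : atom) :
  star (Rule ps a) =
  if ps is [::] then Atom a else Imp (bigand (map premise_star ps)) (Atom a).
Proof. by case: ps. Qed.

(** The formula of an available rule, assumed or in the base, is derivable. *)
Lemma ext_star (B : base) (R : arule) (Rs : seq arule) (Gamma : {fset form}) :
  B R \/ R \in Rs -> ext_derivable B Rs Gamma (star R).
Proof.
elim/arule_nested_ind: R Rs Gamma => ps a IH Rs Gamma BR.
have rule Gamma' : (forall p, p \in ps ->
      ext_derivable B Rs Gamma' (premise_star p)) ->
    ext_derivable B Rs Gamma' (Atom a).
  move=> prem; apply: (Ext_rule BR) => p ps_p.
  have weak : ext_derivable B (p.1 ++ Rs) Gamma' (premise_star p).
    apply: ext_weaken (prem p ps_p) => // R; rewrite mem_cat.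
    by case=> [|->]; [left|right; rewrite orbT].
  move: weak (IH p ps_p); rewrite /premise_star.
  case: (p.1) => [//|R Rs'] weak IHp; apply: Ext_impE weak _.
  apply: ext_bigandI => // F /mapP[R' Rs_R' ->]; apply: IHp => //.
  by right; rewrite mem_cat Rs_R'.
rewrite star_rule; case: ps => [|p0 ps'] in IH BR rule *; first exact: rule.
apply: Ext_impI; apply: rule => p ps_p.
apply: (@ext_bigandE _ _ _ (map premise_star (p0 :: ps'))); first exact: map_f.
by apply: Ext_assumption; rewrite in_fset1U eqxx.
Qed.

(** Extended derivations over [B] use finitely many rules of [B], which can be
    traded for the corresponding formulas. *)
Lemma ext_export (B : base) (Rs : seq arule) (Gamma : {fset form}) (A : form) :
  ext_derivable B Rs Gamma A ->
  exists2 Delta : {fset form}, forall F, F \in Delta -> base_star B F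
    & forall Gamma' : {fset form},
        {subset Gamma <= Gamma'} -> {subset Delta <= Gamma'} ->
        (forall R, R \in Rs -> star R \in Gamma') -> IL Gamma' A.
Proof.
have none : forall F, F \in (fset0 : {fset form}) -> base_star B F by move=> F; rewrite inE.
have union (D1 D2 : {fset form}) :
    (forall F, F \in D1 -> base_star B F) -> (forall F, F \in D2 -> base_star B F) ->
    forall F, F \in D1 `|` D2 -> base_star B F.
  by move=> H1 H2 F; rewrite in_fsetU => /orP[/H1|/H2].
have subU (D1 D2 G : {fset form}) : {subset D1 `|` D2 <= G} ->
    {subset D1 <= G} /\ {subset D2 <= G}.
  by move=> sub; split=> F DF; apply: sub; rewrite in_fsetU DF ?orbT.
have sub1U (F : form) (G G' : {fset form}) : {subset G <= G'} -> {subset G <= F |` G'}.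
  by move=> sub E /sub GE; rewrite in_fset1U GE orbT.
elim=> {Rs Gamma A}.
- move=> Rs Gamma A GA; exists fset0 => // Gamma' sub _ _.
  by apply: Ext_assumption; exact: sub.
- move=> Rs Gamma A1 A2 _ [D1 B1 H1] _ [D2 B2 H2]; exists (D1 `|` D2); first exact: union.
  by move=> Gamma' sub /subU[s1 s2] subR; apply: Ext_andI; [exact: H1|exact: H2].
- move=> Rs Gamma A1 A2 _ [D1 B1 H1]; exists D1 => // Gamma' sub s1 subR.
  by apply: Ext_andE1; exact: H1.
- move=> Rs Gamma A1 A2 _ [D1 B1 H1]; exists D1 => // Gamma' sub s1 subR.
  by apply: Ext_andE2; exact: H1.
- move=> Rs Gamma A1 A2 _ [D1 B1 H1]; exists D1 => // Gamma' sub s1 subR.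
  by apply: Ext_orI1; exact: H1.
- move=> Rs Gamma A1 A2 _ [D1 B1 H1]; exists D1 => // Gamma' sub s1 subR.
  by apply: Ext_orI2; exact: H1.
- move=> Rs Gamma A1 A2 A _ [D B0 H] _ [D1 B1 H1] _ [D2 B2 H2].
  exists (D `|` (D1 `|` D2)); first exact: (union _ _ B0 (union _ _ B1 B2)).
  move=> Gamma' sub /subU[s0 /subU[s1 s2]] subR.
  apply: (@Ext_orE _ _ _ A1 A2); first exact: H.
    apply: H1 => [||R /subR RG]; [exact: subset_fset1U|exact: sub1U|].
    by rewrite in_fset1U RG orbT.
  apply: H2 => [||R /subR RG]; [exact: subset_fset1U|exact: sub1U|].
  by rewrite in_fset1U RG orbT.
- move=> Rs Gamma A1 A2 _ [D1 B1 H1]; exists D1 => // Gamma' sub s1 subR.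
  apply: Ext_impI; apply: H1 => [||R /subR RG]; [exact: subset_fset1U|exact: sub1U|].
  by rewrite in_fset1U RG orbT.
- move=> Rs Gamma A1 A2 _ [D1 B1 H1] _ [D2 B2 H2]; exists (D1 `|` D2); first exact: union.
  move=> Gamma' sub /subU[s1 s2] subR.
  by apply: (@Ext_impE _ _ _ A1); [exact: H1|exact: H2].
- move=> Rs Gamma A _ [D1 B1 H1]; exists D1 => // Gamma' sub s1 subR.
  by apply: Ext_botE; exact: H1.
- move=> Rs Gamma ps a BR _ IH.
  have [D1 B1 H1] : exists2 Delta : {fset form}, forall F, F \in Delta -> base_star B F
      & forall Gamma' : {fset form}, {subset Gamma <= Gamma'} ->
          {subset Delta <= Gamma'} -> (forall R, R \in Rs -> star R \in Gamma') ->
          forall p, p \in ps -> IL Gamma' (premise_star p).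
    elim: ps {BR} IH => [|p0 ps IHps] IH; first by exists fset0.
    have [D1 B1 H1] := IHps (fun p ps_p => IH p (@mem_behead _ (p0 :: ps) p ps_p)).
    have [D2 B2 H2] := IH p0 (mem_head _ _).
    exists (D1 `|` D2); first exact: union.
    move=> Gamma' sub /subU[s1 s2] subR p.
    rewrite in_cons => /orP[/eqP->|]; last exact: H1.
    rewrite /premise_star; case: (p0.1) H2 => [|R0 Rs0] H2; first exact: H2.
    set Rs1 := R0 :: Rs0 in H2 *; apply: Ext_impI.
    (* The formulas of the discharged rules become assumptions, which are then
       obtained by cut from the antecedent of the implication. *)
    pose Gamma'' : {fset form} := Gamma' `|` [fset F in map star Rs1].
    have sub'' : {subset Gamma' <= Gamma''} by move=> F GF; rewrite !inE GF.
    apply: (@ext_cut _ _ Gamma''); last first.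
      apply: H2 => [F /sub/sub''//|F /s2/sub''//|R].
      rewrite mem_cat in_fsetU in_fset => /orP[Rs_R|/subR->//].
      by rewrite map_f ?orbT.
    move=> G; rewrite in_fsetU => /orP[GG|].
      by apply: Ext_assumption; rewrite in_fset1U GG orbT.
    rewrite in_fset => GG; apply: (ext_bigandE GG).
    by apply: Ext_assumption; rewrite in_fset1U eqxx.
  have [D2 B2 R2] : exists2 Delta : {fset form},
      forall F, F \in Delta -> base_star B F
    & star (Rule ps a) \in Delta \/ Rule ps a \in Rs.
    case: BR => [BR|Rs_R]; last by exists fset0 => //; right.
    exists [fset star (Rule ps a)]; last by left; rewrite inE.
    by move=> F; rewrite inE => /eqP->; exists (Rule ps a).
  exists (D1 `|` D2); first exact: union.
  move=> Gamma' sub /subU[s1 s2] subR.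
  have : IL Gamma' (star (Rule ps a)).
    by apply: Ext_assumption; case: R2 => [/s2|/subR].
  move: (H1 _ sub s1 subR); rewrite star_rule.
  case: (ps) => [//|p0 ps'] prem star_der; apply: Ext_impE star_der _.
  by apply: ext_bigandI => // F /mapP[p ps_p ->]; exact: prem.
Qed.

Lemma IL_sub_over (B : base) (Gamma : {fset form}) (A : form) :
  IL Gamma A -> IL_over B Gamma A.
Proof. by apply: ext_weaken => // R [|]. Qed.

Lemma IL_over_exportP (B : base) (Gamma : {fset form}) (A : form) :
  IL_over B Gamma A <->
  exists2 Delta : {fset form}, forall F, F \in Delta -> base_star B F
    & IL (Gamma `|` Delta) A.
Proof.
split=> [/ext_export[Delta B_Delta der]|[Delta B_Delta /(IL_sub_over B)]].
  exists Delta => //.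
  by apply: der => // F GF; rewrite in_fsetU GF ?orbT.
apply: ext_cut => G; rewrite in_fsetU => /orP[|/B_Delta[R BR ->]].
  exact: Ext_assumption.
by apply: ext_star; left.
Qed.

Lemma IL_over_explosion (Gamma : {fset form}) (A : form) :
  IL_over explosion_base Gamma A -> IL Gamma A.
Proof.
case/IL_over_exportP=> Delta exp_Delta; apply: ext_cut => G.
rewrite in_fsetU => /orP[|/exp_Delta[R [a ->] ->]]; first exact: Ext_assumption.
apply: Ext_impI; apply: Ext_botE; apply: Ext_assumption.
by rewrite in_fset1U eqxx.
Qed.

(** * Base-completeness for sound consequence relations *)

(** The equivalence for any consequence relation on bases for which intuitionistic
    logic over bases is sound. *)
Lemma base_complete_of_sound (n : nat) (conB : base -> consequence)
    (con : consequence) :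
  (forall Gamma A, con Gamma A <->
     forall B, base_of_level n B -> conB B Gamma A) ->
  (forall B Gamma A, base_of_level n B -> IL_over B Gamma A -> conB B Gamma A) ->
  base_complete n conB <-> compact_export n conB con /\ complete con.
Proof.
move=> con_all sound; split=> [bc|[export compl] B Gamma A lvlB]; last first.
  case/(export B Gamma A lvlB)=> Delta B_Delta /compl der.
  by apply/IL_over_exportP; exists Delta.
have compl : complete con.
  move=> Gamma A /con_all/(_ _ (base_of_level_explosion n)) conA.
  by apply: IL_over_explosion; apply: bc conA; exact: base_of_level_explosion.
split=> // B Gamma A lvlB; split=> [/(bc _ _ _ lvlB)/IL_over_exportP|].
  move=> [Delta B_Delta der]; exists Delta => //; apply/con_all => B' lvlB'.
  by apply: sound => //; exact: IL_sub_over.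
move=> [Delta B_Delta /compl der]; apply: sound => //.
by apply/IL_over_exportP; exists Delta.
Qed.

(** * Soundness of the two satisfaction relations *)

(** The properties of satisfaction [V A B] on the bases [B] of level at most [n]
    on which the soundness of intuitionistic logic rests. *)
Record intuitionistic (n : nat) (V : form -> base -> Prop) : Prop := {
  int_mono : forall A B C, extends n B C -> V A B -> V A C;
  int_atom : forall a B, V (Atom a) B <-> provable B a;
  int_and : forall A1 A2 B, V (And A1 A2) B <-> V A1 B /\ V A2 B;
  int_orI : forall A1 A2 B, base_of_level n B -> V A1 B \/ V A2 B -> V (Or A1 A2) B;
  int_orE : forall A1 A2 A B, base_of_level n B -> V (Or A1 A2) B ->
    (forall C, extends n B C -> V A1 C -> V A C) ->
    (forall C, extends n B C -> V A2 C -> V A C) -> V A B;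
  int_imp : forall A1 A2 B, V (Imp A1 A2) B <->
    forall C, extends n B C -> V A1 C -> V A2 C;
  int_bot : forall A B, base_of_level n B -> provable B Bot -> V A B }.

Lemma ext_sound (n : nat) (V : form -> base -> Prop) (B : base) (Rs : seq arule)
    (Gamma : {fset form}) (A : form) :
  intuitionistic n V -> ext_derivable B Rs Gamma A ->
  forall C, extends n B C -> (forall R, R \in Rs -> C R) ->
    (forall G, G \in Gamma -> V G C) -> V A C.
Proof.
move=> Vint; have mono := int_mono Vint.
have add1 (Gamma' : {fset form}) F C C' : extends n C C' ->
    (forall G, G \in Gamma' -> V G C) -> V F C' ->
    forall G, G \in F |` Gamma' -> V G C'.
  move=> ext VG VF G; rewrite in_fset1U => /orP[/eqP->//|/VG]; exact: mono.
have ext_ext C C' : extends n B C -> extends n C C' -> extends n B C'.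
  exact: extends_trans.
elim=> {Rs Gamma A}.
- by move=> Rs Gamma A GA C _ _; exact.
- move=> Rs Gamma A1 A2 _ IH1 _ IH2 C BC RC VG; apply/(int_and Vint).
  by split; [exact: IH1|exact: IH2].
- by move=> Rs Gamma A1 A2 _ IH C BC RC VG; case/(int_and Vint): (IH C BC RC VG).
- by move=> Rs Gamma A1 A2 _ IH C BC RC VG; case/(int_and Vint): (IH C BC RC VG).
- by move=> Rs Gamma A1 A2 _ IH C BC RC VG; apply: (int_orI Vint) BC.1 (or_introl _); exact: IH.
- by move=> Rs Gamma A1 A2 _ IH C BC RC VG; apply: (int_orI Vint) BC.1 (or_intror _); exact: IH.
- move=> Rs Gamma A1 A2 A _ IH _ IH1 _ IH2 C BC RC VG.
  apply: (int_orE Vint BC.1 (IH C BC RC VG)) => C' CC' VA.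
    by apply: IH1; [exact: ext_ext CC'|move=> R /RC; exact: CC'.2|exact: (add1 _ _ _ _ CC' VG VA)].
  by apply: IH2; [exact: ext_ext CC'|move=> R /RC; exact: CC'.2|exact: (add1 _ _ _ _ CC' VG VA)].
- move=> Rs Gamma A1 A2 _ IH C BC RC VG; apply/(int_imp Vint) => C' CC' VA.
  by apply: IH; [exact: ext_ext CC'|move=> R /RC; exact: CC'.2|exact: (add1 _ _ _ _ CC' VG VA)].
- move=> Rs Gamma A1 A2 _ IH1 _ IH2 C BC RC VG.
  have /(int_imp Vint) := IH1 C BC RC VG; apply; first exact: extends_refl BC.1.
  exact: IH2.
- move=> Rs Gamma A _ IH C BC RC VG; apply: (int_bot Vint) BC.1 _.
  by apply/(int_atom Vint); exact: IH.
- move=> Rs Gamma ps a BR _ IH C BC RC VG; apply/(int_atom Vint).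
  have CR : C (Rule ps a) by case: BR => [/(proj2 BC)|/RC].
  apply: (provable_rule CR) => p ps_p; apply/(int_atom Vint).
  have CCp := extends_discharged BC.1 CR ps_p.
  apply: IH => //; first exact: ext_ext CCp.
    by move=> R; rewrite mem_cat => /orP[|/RC]; [right|left].
  by move=> G /VG; exact: mono.
Qed.

Lemma consequence_on_sound (n : nat) (V : form -> base -> Prop) (B : base)
    (Gamma : {fset form}) (A : form) :
  intuitionistic n V -> base_of_level n B -> IL_over B Gamma A ->
  consequence_on_of n V B Gamma A.
Proof.
move=> Vint lvlB der; rewrite /consequence_on_of; case: eqP => [G0|_].
  by apply: (ext_sound Vint der) => // G; rewrite G0 inE.
by move=> C BC VG; exact: (ext_sound Vint der).
Qed.

Lemma sat_mono (n : nat) (A : form) (B C : base) :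
  extends n B C -> sat n A B -> sat n A C.
Proof.
move=> BC; elim: A => [a|A1 IH1 A2 IH2|A1 IH1 A2 IH2|A1 _ A2 _] /=.
- by apply: provable_mono; exact: BC.2.
- by case=> /IH1 ? /IH2.
- by case=> [/IH1|/IH2]; [left|right].
- by move=> imp C' CC'; apply: imp; exact: extends_trans CC'.
Qed.

Lemma sat_intuitionistic (n : nat) : intuitionistic n (sat n).
Proof.
split=> //.
- exact: sat_mono.
- move=> A1 A2 A B lvlB [VA|VA] H1 H2.
    exact: (H1 _ (extends_refl lvlB) VA).
  exact: (H2 _ (extends_refl lvlB) VA).
- elim=> [a|A1 IH1 A2 IH2|A1 IH1 A2 _|A1 _ A2 IH2] B lvlB bot /=.
  + exact: (provable_explosion a lvlB bot).
  + by split; [exact: IH1|exact: IH2].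
  + by left; exact: IH1.
  + by move=> C BC _; apply: IH2 BC.1 _; apply: provable_mono bot; exact: BC.2.
Qed.

Lemma sat_s_mono (n : nat) (A : form) (B C : base) :
  extends n B C -> sat_s n A B -> sat_s n A C.
Proof.
move=> BC; elim: A => [a|A1 IH1 A2 IH2|A1 IH1 A2 IH2|A1 _ A2 _] /=.
- by apply: provable_mono; exact: BC.2.
- by case=> /IH1 ? /IH2.
- by move=> or C' CC'; apply: or; exact: extends_trans CC'.
- by move=> imp C' CC'; apply: imp; exact: extends_trans CC'.
Qed.

(** The clause for disjunction mentions atoms only; the elimination rule for
    arbitrary conclusions follows by induction on the conclusion. *)
Lemma sat_s_orE (n : nat) (A1 A2 A : form) (B : base) :
  base_of_level n B -> sat_s n (Or A1 A2) B ->
  (forall C, extends n B C -> sat_s n A1 C -> sat_s n A C) ->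
  (forall C, extends n B C -> sat_s n A2 C -> sat_s n A C) -> sat_s n A B.
Proof.
elim: A B => [a|F1 IH1 F2 IH2|F1 _ F2 _|F1 _ F2 IH2] B lvlB or H1 H2.
- by apply: or => //; exact: extends_refl.
- split; [apply: (IH1 B lvlB or)|apply: (IH2 B lvlB or)] => C BC VA.
  + by case: (H1 C BC VA).
  + by case: (H2 C BC VA).
  + by case: (H1 C BC VA).
  + by case: (H2 C BC VA).
- move=> C BC a HF1 HF2.
  have weaken C' F : extends n C C' ->
      (forall C'', extends n C C'' -> sat_s n F C'' -> provable C'' a) ->
      forall C'', extends n C' C'' -> sat_s n F C'' -> provable C'' a.
    by move=> CC' HF C'' CC''; apply: HF; exact: extends_trans CC''.
  apply: (or C BC a) => C' CC' VA.
    apply: (H1 C' (extends_trans BC CC') VA C' (extends_refl CC'.1) a);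
      exact: weaken.
  apply: (H2 C' (extends_trans BC CC') VA C' (extends_refl CC'.1) a);
    exact: weaken.
- move=> C BC VF1.
  apply: (IH2 C BC.1 (sat_s_mono BC or)) => C' CC' VA.
    exact: (H1 C' (extends_trans BC CC') VA C' (extends_refl CC'.1)
              (sat_s_mono CC' VF1)).
  exact: (H2 C' (extends_trans BC CC') VA C' (extends_refl CC'.1)
            (sat_s_mono CC' VF1)).
Qed.

Lemma sat_s_intuitionistic (n : nat) : intuitionistic n (sat_s n).
Proof.
split=> //.
- exact: sat_s_mono.
- move=> A1 A2 B lvlB VA C BC a H1 H2; case: VA => [/(sat_s_mono BC)|/(sat_s_mono BC)].
    by apply: H1; exact: extends_refl BC.1.
  by apply: H2; exact: extends_refl BC.1.
- exact: sat_s_orE.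
- elim=> [a|A1 IH1 A2 IH2|A1 _ A2 _|A1 _ A2 IH2] B lvlB bot /=.
  + exact: (provable_explosion a lvlB bot).
  + by split; [exact: IH1|exact: IH2].
  + move=> C BC a _ _; apply: provable_explosion BC.1 _.
    by apply: provable_mono bot; exact: BC.2.
  + by move=> C BC _; apply: IH2 BC.1 _; apply: provable_mono bot; exact: BC.2.
Qed.

(** * Substitution in argument structures *)

Lemma flatten_map_nil_in (T : eqType) (U : Type) (f : T -> seq U) (s : seq T)
    (x : T) :
  flatten (map f s) = [::] -> x \in s -> f x = [::].
Proof.
elim: s => //= y s IH; rewrite in_cons => fs0.
case fy0: (f y) fs0 => //= /IH sub.
by case/orP=> [/eqP->|/sub].
Qed.

Lemma mem_assumptions_atD (d e : nat) (D : astr) (A : form) (k : nat) :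
  ((A, k) \in assumptions_at (d + e) D) = ((A, k + e) \in assumptions_at d D).
Proof.
elim/astr_nested_ind: D d => [F j|//|F g Ds IH] d /=.
  case: (leqP (d + e) j) => [le_j|lt_j].
    have -> : d <= j by lia.
    by rewrite !inE /eq_op /=; congr andb; apply/eqP/eqP; lia.
  case: leqP => // le_j; rewrite !inE; apply/esym/eqP => -[_]; lia.
by apply/flatten_mapP/flatten_mapP => -[D Ds_D DA]; exists D => //;
  move: DA; rewrite -IH.
Qed.

Lemma concl_shift_at (c e : nat) (D : astr) : concl (shift_at c e D) = concl D.
Proof. by case: D. Qed.

Lemma assumptions_shift_at (c e : nat) (D : astr) :
  assumptions_at (c + e) (shift_at c e D) = assumptions_at c D.
Proof.
elim/astr_nested_ind: D c => [F j|//|F g Ds IH] c /=.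
  case: (leqP c j) => le_j; first by rewrite leq_add2r le_j subnDr.
  by case: leqP => //; lia.
by rewrite -map_comp; congr flatten; apply/eq_in_map => D /IH /=; rewrite -addSn.
Qed.

Lemma has_flatten (T : Type) (a : pred T) (ss : seq (seq T)) :
  has a (flatten ss) = has (has a) ss.
Proof. by elim: ss => //= s ss IH; rewrite has_cat IH. Qed.

(** Shifting does not affect the assumptions discharged at the node [d]. *)
Lemma has_discharged_shift_at (c d e : nat) (D : astr) :
  has (fun p => p.2 == 0) (assumptions_at d (shift_at (d + c.+1) e D)) =
  has (fun p => p.2 == 0) (assumptions_at d D).
Proof.
elim/astr_nested_ind: D d => [F j|//|F g Ds IH] d /=.
  case: (leqP (d + c.+1) j) => [le_j|//].
  have -> : d <= j + e by lia.
  have -> : d <= j by lia.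
  by rewrite /= !orbF; apply/eqP/eqP; lia.
rewrite -map_comp !has_flatten !has_map; apply: eq_in_has => D Ds_D.
exact: (IH D Ds_D d.+1).
Qed.

Lemma atomic_node_shift_at (c e : nat) (A : form) (Ds : seq astr) :
  atomic_node A (map (shift_at c.+1 e) Ds) = atomic_node A Ds.
Proof.
rewrite /atomic_node /discharges_assumption all_map has_map.
congr [&& _, _ & ~~ _]; first by apply: eq_all => D /=; rewrite concl_shift_at.
by apply: eq_has => D; exact: (has_discharged_shift_at c 0 e D).
Qed.

(** The nodes [b'] are inserted below the outermost node of [b], or below the
    root of [D] if [b] is empty, and the addresses that pointed beyond that node
    are made to point beyond the new ones. *)
Lemma wf_in_shift_at (b b' : seq bool) (D : astr) :
  wf_in (b ++ b') (shift_at (size b) (size b') D) = wf_in b D.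
Proof.
have target k : nth true (b ++ b') (if size b <= k then k + size b' else k) =
                nth true b k.
  case: (leqP (size b) k) => [le_k|lt_k]; last by rewrite nth_cat lt_k.
  by rewrite !nth_default ?size_cat //; lia.
elim/astr_nested_ind: D b target => [//|F [k|] //=|F g Ds IH] b target.
have sub : all (wf_in (atomic_node F Ds :: b ++ b'))
               (map (shift_at (size b).+1 (size b')) Ds) =
           all (wf_in (atomic_node F Ds :: b)) Ds.
  rewrite all_map; apply: eq_in_all => D Ds_D.
  apply: (IH D Ds_D (atomic_node F Ds :: b)) => -[|k] //=.
  rewrite ltnS -(target k); case: leqP => // _; by rewrite addSn.
rewrite /= atomic_node_shift_at sub /nilp size_map.
by case: g => [k|] //=; rewrite target.
Qed.

Lemma subst_at_closed (sigma : form * nat -> astr) (d : nat) (D : astr) :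
  assumptions_at d D = [::] -> subst_at sigma d D = D.
Proof.
elim/astr_nested_ind: D d => [F j|//|F g Ds IH] d /=; first by case: leqP.
move=> as0; congr Infer; rewrite -[RHS]map_id; apply/eq_in_map => D Ds_D.
by apply: IH => //; exact: flatten_map_nil_in as0 Ds_D.
Qed.

Lemma subst_closed (sigma : form * nat -> astr) (D : astr) :
  closed D -> subst sigma D = D.
Proof. by move/nilP; exact: subst_at_closed. Qed.

Lemma assumptions_subst_at (sigma : form * nat -> astr) (d : nat) (D : astr) :
  (forall p, p \in assumptions_at d D -> closed (sigma p)) ->
  assumptions_at d (subst_at sigma d D) = [::].
Proof.
elim/astr_nested_ind: D d => [F j|//|F g Ds IH] d /= clo.
  case: leqP clo => [le_j|lt_j] clo; last by rewrite /= leqNgt lt_j.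
  rewrite -[d in assumptions_at d]add0n assumptions_shift_at.
  by apply/nilP/clo; rewrite inE.
rewrite -map_comp; apply: flatten_map_nil => D Ds_D /=; apply: IH => // p Dp.
by apply: clo; apply/flatten_mapP; exists D.
Qed.

Lemma closed_subst (sigma : form * nat -> astr) (D : astr) :
  (forall p, p \in assumptions D -> closed (sigma p)) -> closed (subst sigma D).
Proof. by move=> clo; apply/nilP; exact: assumptions_subst_at. Qed.

Lemma concl_subst (sigma : form * nat -> astr) (D : astr) :
  assignment sigma D -> concl (subst sigma D) = concl D.
Proof.
case: D => // F j asg; rewrite /subst /= concl_shift_at subn0.
by have [] := asg (F, j); rewrite /assumptions /= ?subn0 ?inE.
Qed.

Lemma mem_undischarged (D : astr) (A : form) :
  (A \in undischarged D) = (A \in map fst (assumptions D)).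
Proof. by rewrite in_fset. Qed.

Lemma undischarged_eq0 (D : astr) : (undischarged D == fset0) = closed D.
Proof.
apply/eqP/nilP => [D0|as0]; last first.
  by apply/fsetP=> A; rewrite mem_undischarged as0 !inE.
case: (assumptions D) (mem_undischarged D) => // p s mem.
by have := mem p.1; rewrite D0 inE /= mem_head.
Qed.

(** In a closed structure, the assumptions of an immediate sub-structure are
    discharged at the root. *)
Lemma closed_premise (A : form) (g : option nat) (Ds : seq astr) (D : astr)
    (p : form * nat) :
  closed (Infer A g Ds) -> D \in Ds -> p \in assumptions D -> p.2 = 0.
Proof.
move/nilP=> as0 Ds_D.
have as1 : assumptions_at (0 + 1) D = [::] := flatten_map_nil_in as0 Ds_D.
by case: p => F [|k] //; rewrite -[k.+1]addn1 -mem_assumptions_atD as1.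
Qed.

Lemma closed_premise_undischarged (A : form) (g : option nat) (Ds : seq astr)
    (D : astr) :
  closed (Infer A g Ds) -> ~~ discharges_assumption Ds -> D \in Ds -> closed D.
Proof.
move=> clo /hasPn nodis Ds_D; apply/nilP.
case: (assumptions D) (nodis D Ds_D) (fun p => @closed_premise A g Ds D p clo Ds_D).
  by [].
by move=> p s /hasPn/(_ p (mem_head _ _)) /eqP ne0 /(_ p (mem_head _ _)).
Qed.

(** * Reductions *)

Lemma recursive_true (T : countType) : recursive (fun _ : T => True).
Proof.
exists (RComp RSucc [:: RZero]) => x; split=> // _.
apply: (@Eval_comp _ _ _ [:: 0]) => // [[|i]//= _|]; first exact: Eval_zero.
exact: Eval_succ.
Qed.

(** The structure ends with an inference. *)
Definition inner (D : astr) : bool := if D is Infer _ _ _ then true else false.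

(** The reduction that replaces by [E] every closed structure with the same
    conclusion that ends with an inference.  If [E] is closed, the set of these
    structures and the value are invariant under substitution, as is required of
    a reduction. *)
Definition replace_by (E D : astr) : option astr :=
  if [&& is_structure D, closed D, inner D & concl D == concl E] then Some E
  else None.

Lemma replace_by_reduction (E : astr) :
  is_structure E -> closed E -> assumed_rules E = [::] -> reduction (replace_by E).
Proof.
move=> wfE cloE rulesE; exists (fun _ => True); first exact: recursive_true.
move=> D E'; rewrite /replace_by.
case: ifP => // /and4P[wfD cloD innerD /eqP eqD] [<-]; split=> //.
- by case: D innerD {wfD cloD eqD} => // A g Ds _; exists (Ds, A) => //; exists g.
- by rewrite (nilP cloE) rulesE; split.
- by move=> sigma _; rewrite !subst_closed // wfD cloD innerD eqD eqxx.
Qed.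

Lemma reduces_replace (J : redset) (D E : astr) :
  (forall phi, reduction phi -> J phi) ->
  is_structure D -> closed D -> inner D ->
  is_structure E -> closed E -> assumed_rules E = [::] ->
  concl E = concl D -> reduces J D E.
Proof.
move=> allJ wfD cloD innerD wfE cloE rulesE eqE; apply: rt_step.
apply: (@Reduces_root _ (replace_by E)).
  by apply: allJ; exact: replace_by_reduction.
by rewrite /replace_by wfD cloD innerD eqE eqxx.
Qed.

Lemma reduces_concl (J : redset) (D E : astr) :
  is_redset J -> reduces J D E -> concl E = concl D.
Proof.
move=> redJ; elim=> {D E} [D E|//|D E F _ <- _ <-] // [phi D' E'|//].
by move=> /redJ[R _ red] /red[].
Qed.

Lemma reduces_closed (J : redset) (D E : astr) :
  is_redset J -> reduces J D E -> closed D -> closed E.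
Proof.
move=> redJ; elim=> {D E} [D E red|//|D E F _ IH1 _ IH2 /IH1 //].
suff sub d : {subset assumptions_at d E <= assumptions_at d D}.
  have {}sub : {subset assumptions E <= assumptions D} := sub 0.
  move/nilP=> as0; apply/nilP; case: (assumptions E) sub => // p s.
  by rewrite as0 => /(_ p (mem_head _ _)).
elim: red d => {D E} [phi D E /redJ[R _ red] /red[_ _ _ [sub _] _]|A g Ds1 D E Ds2 _ IH] d.
  by move=> [F k]; rewrite -[d]add0n !mem_assumptions_atD => /sub.
by move=> p; rewrite /= !map_cat !flatten_cat !mem_cat /= => /or3P[->|/IH->|->];
  rewrite ?orbT.
Qed.

Lemma canonical_Infer (A : form) (g : option nat) (Ds : seq astr) :
  canonical (Infer A g Ds) <-> introduction (Ds, A).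
Proof.
split=> [[[Ds' A'] intro [g' /= [-> _ ->]]] //|intro].
by exists (Ds, A) => //; exists g.
Qed.

(** * Reducibility semantics agrees with the standard one *)

(** A single inference of [A] from the undischarged assumptions [As].  The axiom
    leaf ensures that there is a premise even if [As] is empty. *)
Definition step (As : seq form) (A : form) : astr :=
  Infer A None (Axm (Atom Bot) None :: map (fun F => Assum F 1) As).

Lemma assumptions_step (As : seq form) (A : form) :
  assumptions (step As A) = map (fun F => (F, 0)) As.
Proof. by rewrite /assumptions /=; elim: As => //= F As ->. Qed.

Lemma is_structure_step (As : seq form) (A : form) : is_structure (step As A).
Proof. by rewrite /is_structure /= all_map; apply/allP. Qed.

Lemma undischarged_step (Gamma : {fset form}) (A : form) :
  undischarged (step Gamma A) = Gamma.
Proof.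
apply/fsetP=> F; rewrite mem_undischarged assumptions_step -map_comp.
by rewrite (@eq_map _ _ _ id) ?map_id.
Qed.

Lemma is_structure_subst_step (As : seq form) (A : form)
    (sigma : form * nat -> astr) :
  assignment sigma (step As A) -> is_structure (subst sigma (step As A)).
Proof.
move=> asg; rewrite /is_structure /= -map_comp all_map; apply/allP=> F As_F /=.
set b := atomic_node _ _; rewrite (@wf_in_shift_at [::] [:: b]) subnn.
by have [] := asg (F, 0); first by rewrite assumptions_step (map_f (fun F => (F, 0))).
Qed.

(** Both directions are proved together, since in the case of an implication each
    needs the other one for the antecedent: satisfaction from validity requires
    a valid closed argument for the antecedent, and validity from satisfaction
    requires that a given one makes the antecedent satisfied. *)
Lemma valid_closed_sat (n : nat) (A : form) :
  (forall J B D, is_redset J -> base_of_level n B -> closed D -> concl D = A ->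
     valid_closed n A J B D -> sat n A B) /\
  (forall J B D, (forall phi, reduction phi -> J phi) -> base_of_level n B ->
     is_structure D -> closed D -> inner D -> concl D = A ->
     sat n A B -> valid_closed n A J B D).
Proof.
elim: A => [a|A1 [IHs1 IHv1] A2 [IHs2 IHv2]|A1 [IHs1 IHv1] A2 [IHs2 IHv2]
           |A1 [IHs1 IHv1] A2 [IHs2 IHv2]]; split=> J B D.
- move=> redJ lvlB cloD eqD [E [red der]]; exists E; split=> //.
  by rewrite (reduces_concl redJ red).
- move=> allJ lvlB wfD cloD innerD eqD /provableP.
  case/(@atomic_derivable_derivation _ _ _ [::]) => // E [der eqE [as0 rules0 wfE]].
  exists E; split=> //; apply: reduces_replace => //; first exact: wfE.
    by apply/nilP; exact: as0.
  by rewrite eqE.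
- move=> redJ lvlB cloD eqD [g [D1 [D2 [red /canonical_Infer/= can v1 v2]]]].
  have cloE := reduces_closed redJ red cloD.
  case/and3P: can => /eqP eq1 /eqP eq2 nodis.
  have clo E := @closed_premise_undischarged _ _ _ E cloE nodis.
  split; [apply: IHs1 v1|apply: IHs2 v2] => //; apply: clo;
    by rewrite !inE eqxx ?orbT.
- move=> allJ lvlB wfD cloD innerD eqD [sat1 sat2].
  exists None, (step [::] A1), (step [::] A2); split.
  + by apply: reduces_replace.
  + by apply/canonical_Infer; rewrite /= !eqxx.
  + exact: IHv1.
  + exact: IHv2.
- move=> redJ lvlB cloD eqD [g [D1 [red /canonical_Infer/= can v]]].
  have cloE := reduces_closed redJ red cloD.
  case/andP: can => _ nodis.
  have clo := closed_premise_undischarged cloE nodis (mem_head _ _).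
  by case: v => -[eq1 v]; [left; exact: IHs1 v|right; exact: IHs2 v].
- move=> allJ lvlB wfD cloD innerD eqD.
  case=> satA; [exists None, (step [::] A1)|exists None, (step [::] A2)]; split.
  + by apply: reduces_replace.
  + by apply/canonical_Infer; rewrite /= eqxx.
  + by left; split=> //; exact: IHv1.
  + by apply: reduces_replace.
  + by apply/canonical_Infer; rewrite /= eqxx orbT.
  + by right; split=> //; exact: IHv2.
- move=> redJ lvlB cloD eqD [g [D1 [red /canonical_Infer/= can v]]] C BC sat1.
  have cloE := reduces_closed redJ red cloD.
  case/andP: can => /eqP eq2 /allP dis.
  move: v; rewrite /valid_of; case: ifP => [clo1 v|_ v].
    by apply: sat_mono BC _; exact: IHs2 v.
  have dis1 p : p \in assumptions D1 -> p.1 = A1.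
    move=> D1p; apply/eqP; have := dis p D1p.
    by rewrite (closed_premise cloE (mem_head _ _) D1p).
  (* With all reductions at hand, any closed inference of A1 is valid on C, so its
     shape is immaterial. *)
  pose sigma (_ : form * nat) := step [::] A1.
  have asg : assignment sigma D1.
    by move=> p /dis1 ->; split=> //; exact: is_structure_step.
  apply: (IHs2 reduction C (subst sigma D1)) => //.
  + by case: BC.
  + exact: closed_subst.
  + by rewrite concl_subst.
  + apply: v => // p _; apply: IHv1 => //; by case: BC.
- move=> allJ lvlB wfD cloD innerD eqD sat12.
  exists None, (step [:: A1] A2); split.
  + by apply: reduces_replace.
  + by apply/canonical_Infer; rewrite /= !eqxx.
  + rewrite /valid_of /= => sigma J' C asg clo redJ' JJ' BC v1.
    apply: IHv2 => //.
    * by move=> phi /allJ/JJ'.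
    * by case: BC.
    * exact: is_structure_subst_step.
    * exact: closed_subst.
    * apply: sat12 => //; have A1_in : (A1, 0) \in assumptions (step [:: A1] A2).
        by rewrite mem_head.
      apply: IHs1 (v1 _ A1_in) => //; first by case: BC.
        exact: clo.
      by have [] := asg _ A1_in.
Qed.

Lemma valid_consequence_on (n : nat) (J : redset) (B : base) (D : astr) :
  is_redset J -> base_of_level n B -> valid n J B D ->
  consequence_on_of n (sat n) B (undischarged D) (concl D).
Proof.
move=> redJ lvlB; rewrite /valid /valid_of /consequence_on_of undischarged_eq0.
case: ifP => [cloD v|_ v C BC satG].
  by apply: (valid_closed_sat n (concl D)).1 v.
pose sigma (p : form * nat) := step [::] p.1.
have asg : assignment sigma D by move=> p _; split=> //; exact: is_structure_step.
have lvlC : base_of_level n C by case: BC.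
apply: ((valid_closed_sat n (concl D)).1 reduction C (subst sigma D)) => //.
- exact: closed_subst.
- exact: concl_subst.
- apply: v => // p Dp; apply: (valid_closed_sat n p.1).2 => //.
  by apply: satG; rewrite mem_undischarged map_f.
Qed.

Lemma valid_step (n : nat) (B : base) (Gamma : {fset form}) (A : form) :
  base_of_level n B -> consequence_on_of n (sat n) B Gamma A ->
  valid n reduction B (step Gamma A).
Proof.
move=> lvlB; rewrite /valid /valid_of /consequence_on_of.
rewrite -undischarged_eq0 undischarged_step; case: ifP => [/eqP->|_] conA.
  by apply: (valid_closed_sat n A).2.
move=> sigma J' C asg clo redJ' JJ' BC v; have lvlC : base_of_level n C by case: BC.
apply: (valid_closed_sat n A).2 => //.
- exact: is_structure_subst_step.
- exact: closed_subst.
- apply: conA => // G GG.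
  have G_in : (G, 0) \in assumptions (step Gamma A).
    by rewrite assumptions_step (map_f (fun F => (F, 0))).
  apply: (valid_closed_sat n G).1 (v _ G_in) => //; first exact: clo.
  by have [] := asg _ G_in.
Qed.

Lemma consequence_on_aP (n : nat) (B : base) (Gamma : {fset form}) (A : form) :
  base_of_level n B ->
  consequence_on_a n B Gamma A <-> consequence_on_of n (sat n) B Gamma A.
Proof.
move=> lvlB; split=> [[D [J [[_ redJ] <- <-]]]|conA]; first exact: valid_consequence_on.
exists (step Gamma A), reduction; split=> //.
- by split=> //; exact: is_structure_step.
- exact: undischarged_step.
- exact: valid_step.
Qed.

Lemma consequence_aP (n : nat) (Gamma : {fset form}) (A : form) :
  consequence_a n Gamma A <-> consequence_of n (sat n) Gamma A.
Proof.
split=> [[D [J [[_ redJ] <- <- v]]] B lvlB|conA].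
  by apply: valid_consequence_on (v B lvlB).
exists (step Gamma A), reduction; split=> //.
- by split=> //; exact: is_structure_step.
- exact: undischarged_step.
- by move=> B lvlB; apply: valid_step => //; exact: conA.
Qed.

Theorem theorem18 (n : nat) (s : semantics) :
  base_complete n (consequence_on s n) <->
  compact_export n (consequence_on s n) (consequence_n s n) /\
  complete (consequence_n s n).
Proof.
apply: base_complete_of_sound; case: s => //=.
- move=> Gamma A; rewrite consequence_aP.
  by split=> con B lvlB; have := con B lvlB; rewrite consequence_on_aP.
- by move=> B Gamma A lvlB; apply: consequence_on_sound => //; exact: sat_intuitionistic.
- move=> B Gamma A lvlB der; apply/consequence_on_aP => //.
  exact: consequence_on_sound (sat_intuitionistic n) lvlB der.
- by move=> B Gamma A lvlB; apply: consequence_on_sound => //; exact: sat_s_intuitionistic.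
Qed.
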